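(* The graph class $\{Q_n : n\ge 1\}$ is not tree-width fragile.
   Context: For an integer $n\ge 1$, $Q_n$ is the simple undirected graph with vertex set $\{(x,y,z)\in\mathbb{Z}^3: 0\le x,y,z\le n-1\}$ in which two distinct vertices are adjacent if they can be named $(x,y,z)$ and $(x',y',z')$ in such a way that $x\le x'\le x+1$, $y\le y'\le y+1$ and $z\le z'\le z+1$. The tree-width $\operatorname{tw}(G)$ of a graph $G$ is the minimum width of its tree decompositions, where the width of a tree decomposition is the maximum size of its bags minus one. A class $\mathcal{G}$ of graphs is tree-width fragile if for every integer $k\ge 1$ there exists $t_k\ge 0$ such that for every graph $G\in\mathcal{G}$ there exist pairwise disjoint sets $A_1,\ldots,A_k\subseteq V(G)$ satisfying $\operatorname{tw}(G-A_i)\le t_k$ for $1\le i\le k$. *)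

(* Defs.v *)
From mathcomp Require Import all_boot all_order all_algebra.
From mathcomp Require Import boolp.

Set Implicit Arguments.
Unset Strict Implicit.
Unset Printing Implicit Defensive.

Import Order.TTheory GRing.Theory Num.Theory.

(* Finite simple undirected graphs. *)
Record sgraph := SGraph {
  vertex :> finType;
  adj : rel vertex;
  adj_sym : symmetric adj;
  adj_irr : irreflexive adj }.

Section Induced.
Variables (G : sgraph) (S : {set G}).

Definition induced_adj : rel {x : G | x \in S} :=
  [rel x y | adj (val x) (val y)].

Lemma induced_adj_sym : symmetric induced_adj.
Proof. by move=> x y; exact: adj_sym. Qed.

Lemma induced_adj_irr : irreflexive induced_adj.
Proof. by move=> x; exact: adj_irr. Qed.

Definition induced : sgraph := SGraph induced_adj_sym induced_adj_irr.
End Induced.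

Definition del_vertices (G : sgraph) (A : {set G}) : sgraph := induced (~: A).

(* The null graph is not connected. *)
Definition connected (G : sgraph) : Prop :=
  0 < #|G| /\ forall x y : G, connect (@adj G) x y.

(* [cycle] accepts a closed walk x, y, x along a single edge, hence the bound
   on the length. *)
Definition acyclic (G : sgraph) : Prop :=
  forall c : seq G, uniq c -> 2 < size c -> ~~ cycle (@adj G) c.

Definition is_tree (T : sgraph) : Prop := connected T /\ acyclic T.

Record tree_decomposition (G : sgraph) := TreeDecomposition {
  td_tree : sgraph;
  td_bag : td_tree -> {set G};
  td_treeP : is_tree td_tree;
  td_edge : forall u v : G, adj u v ->
    exists t : td_tree, u \in td_bag t /\ v \in td_bag t;
  (* nonemptiness of this set, i.e. that every vertex lies in some bag, is part
     of [connected] *)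
  td_subtree : forall v : G, connected (induced [set t | v \in td_bag t]) }.

Definition max_bag (G : sgraph) (D : tree_decomposition G) : nat :=
  \max_(t : td_tree D) #|td_bag t|.

(* An integer: it can be -1 when G has no vertices. *)
Definition width (G : sgraph) (D : tree_decomposition G) : int :=
  ((max_bag D)%:Z - 1)%R.

Section TrivialDecomposition.
Variable G : sgraph.

Definition one_vertex : sgraph :=
  @SGraph unit (fun _ _ => false) (fun _ _ => erefl) (fun _ => erefl).

Lemma one_vertex_tree : is_tree one_vertex.
Proof.
split; first by split=> [|[] []]; [rewrite card_unit | exact: connect0].
by move=> c /card_uniqP <-; rewrite ltnNge (leq_trans (max_card _)) // card_unit.
Qed.

Lemma one_vertex_bag_connected (v : G) :
  connected (induced [set t : one_vertex | v \in [set: G]]).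
Proof.
split=> [|x y].
  have tt_in : (tt : one_vertex) \in [set t : one_vertex | v \in [set: G]].
    by rewrite !inE.
  by apply/card_gt0P; exists (exist _ tt tt_in).
have -> : x = y by apply: val_inj; case: (val x); case: (val y).
exact: connect0.
Qed.

Definition trivial_decomposition : tree_decomposition G :=
  @TreeDecomposition G one_vertex (fun=> [set: G]) one_vertex_tree
    (fun u v _ => ex_intro _ tt (conj (in_setT u) (in_setT v)))
    one_vertex_bag_connected.

Lemma max_bag_exists :
  exists n, `[< exists D : tree_decomposition G, max_bag D = n >].
Proof.
by exists (max_bag trivial_decomposition); apply/asboolP; exists trivial_decomposition.
Qed.
End TrivialDecomposition.

(* The minimum of [width]; it is taken on bag sizes so that it ranges over
   [nat], see [twP]. *)
Definition tw (G : sgraph) : int := ((ex_minn (max_bag_exists G))%:Z - 1)%R.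

Lemma twP (G : sgraph) :
  (exists D : tree_decomposition G, width D = tw G) /\
  (forall D : tree_decomposition G, tw G <= width D)%R.
Proof.
rewrite /tw /width; case: ex_minnP => n /asboolP[D <-] min_n.
split; first by exists D.
by move=> D'; rewrite lerD2r lez_nat min_n //; apply/asboolP; exists D'.
Qed.

Definition tw_fragile (C : sgraph -> Prop) : Prop :=
  forall k : nat, 1 <= k ->
  exists t : nat, forall G : sgraph, C G ->
  exists A : 'I_k -> {set G},
    (forall i j : 'I_k, i != j -> [disjoint A i & A j]) /\
    (forall i : 'I_k, (tw (del_vertices (A i)) <= t%:Z)%R).

Section Q.
Variable n : nat.

(* The triple (x, y, z) is represented as ((x, y), z). *)
Definition Q_step : rel ('I_n * 'I_n * 'I_n) := fun u v =>
  [&& u.1.1 <= v.1.1 <= u.1.1.+1,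
      u.1.2 <= v.1.2 <= u.1.2.+1 &
      u.2 <= v.2 <= u.2.+1].

Definition Q_adj : rel ('I_n * 'I_n * 'I_n) := fun u v =>
  (u != v) && (Q_step u v || Q_step v u).

Lemma Q_adj_sym : symmetric Q_adj.
Proof. by move=> u v; rewrite /Q_adj eq_sym orbC. Qed.

Lemma Q_adj_irr : irreflexive Q_adj.
Proof. by move=> u; rewrite /Q_adj eqxx. Qed.

Definition Q : sgraph := SGraph Q_adj_sym Q_adj_irr.
End Q.

(* Main.v *)
Require Import Defs.
From mathcomp Require Import all_boot all_order all_algebra boolp zify ring.

(* Suppose V(Q_n) is split into A and B, both of bounded tree-width; already the
   case k = 2 leads to a contradiction. Since degrees are bounded, A and B have
   tree-partitions with bags of bounded size (Ding-Oporowski). Cut every bag of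
   A into its connected pieces, and every bag of B into its R-chain components,
   where R exceeds the diameter of the pieces of A. Contracting these clusters
   moves every vertex by a bounded distance, so Sperner's lemma for the
   triangulation of the cube by the cliques of Q_n produces an odd number of
   tetrahedra with four labels, all close to the center.

   On the other hand every triangle inside A or inside B meets at most two
   clusters, so such a tetrahedron consists of an edge of A joining two clusters
   a, a' and an edge of B. Around a and a' the clusters of B are determined by
   the nodes of the tree of B, because R is large. Hence the edges of B that
   carry the two remaining labels form a cut there, and the tetrahedra
   containing a given pair a, a' cancel modulo 2. *)

Set Implicit Arguments.
Unset Strict Implicit.
Unset Printing Implicit Defensive.

(** * Tree-partitions *)

Section TreePartition.
Variables (V : finType) (e : rel V).
Hypothesis e_sym : symmetric e.

(* [U] is the union of the bags, [R] the bag of the root; every bag other than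
   the root has at most [w] elements, the size of [R] is not constrained. *)
Inductive tree_partition (w : nat) : {set V} -> {set V} -> Prop :=
| TProot R : tree_partition w R R
| TPattach U R U' R' :
    tree_partition w U R -> tree_partition w U' R' -> #|R'| <= w ->
    [disjoint U & U'] ->
    (forall u v, u \in U -> v \in U' -> e u v -> u \in R /\ v \in R') ->
    tree_partition w (U :|: U') R.

Lemma tree_partition_root w U R : tree_partition w U R -> R \subset U.
Proof. by elim=> // *; exact/subsetU/orP/or_introl. Qed.

(** No edge joins [U] minus [X] to [X] minus [U], so only vertices of [R] have edges into the
    attached subtrees, which can stay where they are. *)
Lemma tree_partition_enlarge w U R (X : {set V}) :
  tree_partition w U R ->
  (forall x, x \in U -> x \in X -> x \in R) ->
  (forall u x, u \in U -> x \in X -> e u x -> u \in X \/ x \in U) ->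
  tree_partition w (U :|: X) (R :|: X).
Proof.
elim=> [R0 _ _|{}U {}R U' R' tpU IH tpU' _ leR' dis edg UX eX]; first exact: TProot.
have RU := subsetP (tree_partition_root tpU).
have XU' x : x \in X -> x \in U' -> False.
  move=> xX xU'; have := RU _ (UX x _ xX); rewrite inE xU' orbT => /(_ isT) xU.
  by have := disjointFr dis xU; rewrite xU'.
rewrite setUAC; apply: TPattach (tpU') leR' _ _.
- apply: IH => [x xU xX|u x uU xX eux]; first by apply: UX; rewrite ?inE ?xU.
  have [|uX|xUU'] := eX u x _ xX eux; first by rewrite inE uU.
    by left.
  by right; apply/RU/UX.
- rewrite disjoints_subset; apply/subsetP => x; rewrite !inE => /orP[xU|xX].
    by rewrite (disjointFr dis xU).
  by apply/negP; exact: XU'.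
move=> u v; rewrite !inE => /orP[uU|uX] vU' euv.
  by have [-> ->] := edg u v uU vU' euv.
have [||vX|uUU'] := eX v u _ uX; rewrite ?inE ?vU' ?orbT 1?e_sym //.
  by case: (XU' v).
by have [-> ->] := edg u v (RU _ (UX u uUU' uX)) vU' euv.
Qed.

(** The subtrees of the second partition are hung one by one on the union of the two root bags. *)
Lemma tree_partition_merge w U1 R1 U2 R2 :
  tree_partition w U1 R1 -> tree_partition w U2 R2 ->
  (forall x, x \in U1 -> x \in U2 -> x \in R1 /\ x \in R2) ->
  (forall u v, u \in U1 -> v \in U2 -> e u v -> u \in U2 \/ v \in U1) ->
  tree_partition w (U1 :|: U2) (R1 :|: R2).
Proof.
move=> tp1; elim=> [R inR eR|U R U' R' tpU IH tpU' _ leR' dis edg inR eR].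
  by apply: tree_partition_enlarge => // x x1 /(inR x x1)[].
have RU := subsetP (tree_partition_root tpU).
have UU' x : x \in U1 -> x \in U :|: U' -> x \in U.
  by move=> x1 x2; have [_ /RU] := inR x x1 x2.
rewrite setUA; apply: TPattach (tpU') leR' _ _.
- apply: IH => [x x1 xU|u v u1 vU euv]; first by apply: inR; rewrite ?inE ?xU.
  have [|/(UU' _ u1)|] := eR u v u1 _ euv; rewrite ?inE ?vU //; first by left.
  by right.
- rewrite disjoints_subset; apply/subsetP => x; rewrite !inE => /orP[x1|xU].
    apply/negP => xU'; have := disjointFr dis (UU' x x1 _).
    by rewrite inE xU' orbT => /(_ isT).
  by rewrite (disjointFr dis xU).
move=> u v /setUP[u1|uU] vU' euv; last first.
  by have [uR ->] := edg u v uU vU' euv; rewrite inE uR orbT.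
have vUU' : v \in U :|: U' by rewrite inE vU' orbT.
have [/(UU' _ u1) uU|v1] := eR u v u1 vUU' euv.
  by have [uR ->] := edg u v uU vU' euv; rewrite inE uR orbT.
by have := disjointFr dis (UU' v v1 vUU'); rewrite vU'.
Qed.

(** The last two clauses are properties of trees: there are no triangles, and modulo 2 every
    symmetric function on the edges is the coboundary of a function on the nodes. *)
Lemma tree_partition_bags w U R : tree_partition w U R ->
  exists b : V -> {set V},
  [/\ forall v, v \in U -> v \in b v /\ b v \subset U,
      forall v, v \in U -> b v = R \/ #|b v| <= w,
      forall v, v \in R -> b v = R,
      forall x y z, x \in U -> y \in U -> z \in U -> e x y -> e x z -> e y z ->
        [|| b x == b y, b x == b z | b y == b z] &
      forall c : rel {set V}, symmetric c -> irreflexive c ->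
      exists phi : {set V} -> bool, forall u v, u \in U -> v \in U -> e u v ->
        phi (b u) (+) phi (b v) = c (b u) (b v)].
Proof.
elim=> [{}R|{}U {}R U' R' tpU [b1 [b1U b1w b1R tri1 cob1]] tpU'].
  exists (fun=> R); split=> // [v _|x y z *|c _ c_irr]; first by left.
    by rewrite eqxx.
  by exists (fun=> false) => u v _ _ _; rewrite c_irr.
case=> b2 [b2U b2w b2R tri2 cob2] leR' dis edg.
have RU := subsetP (tree_partition_root tpU).
have RU' := subsetP (tree_partition_root tpU').
have disF v : v \in U' -> (v \in U) = false by move=> vU'; rewrite (disjointFl dis vU').
pose b v := if v \in U then b1 v else b2 v.
have bU v : v \in U -> b v = b1 v by rewrite /b => ->.
have bU' v : v \in U' -> b v = b2 v by rewrite /b => /disF ->.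
have sb v : v \in U' -> (b v \subset U) = false.
  move=> vU'; apply/negP => /subsetP /(_ v); rewrite bU' // disF //.
  by move=> /(_ (b2U v vU').1).
have ecross u v : u \in U -> v \in U' -> e u v -> b u = R /\ b v = R'.
  move=> uU vU' euv; have [uR vR'] := edg u v uU vU' euv.
  by rewrite bU // b1R // bU' // b2R.
exists b; split=> [v|v|v vR|x y z|c c_sym c_irr].
- case/setUP=> vU.
    rewrite bU //; have [? s] := b1U v vU; split=> //.
    exact/subsetU/orP/or_introl.
  rewrite bU' //; have [? s] := b2U v vU; split=> //.
  exact/subsetU/orP/or_intror.
- case/setUP=> vU; first by rewrite bU //; exact: b1w.
  by rewrite bU' //; right; have [->|] := b2w v vU.
- by rewrite bU ?b1R // RU.
- move=> xU yU zU exy exz eyz.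
  have eyx : e y x by rewrite e_sym.
  have ezx : e z x by rewrite e_sym.
  have ezy : e z y by rewrite e_sym.
  case/setUP: xU => xU; case/setUP: yU => yU; case/setUP: zU => zU.
  + by rewrite !bU //; exact: tri1.
  + have [-> _] := ecross _ _ xU zU exz.
    by have [-> _] := ecross _ _ yU zU eyz; rewrite eqxx.
  + have [-> _] := ecross _ _ xU yU exy.
    by have [-> _] := ecross _ _ zU yU ezy; rewrite eqxx /= ?orbT.
  + have [_ ->] := ecross _ _ xU yU exy.
    by have [_ ->] := ecross _ _ xU zU exz; rewrite eqxx /= ?orbT.
  + have [-> _] := ecross _ _ yU xU eyx.
    by have [-> _] := ecross _ _ zU xU ezx; rewrite eqxx /= ?orbT.
  + have [_ ->] := ecross _ _ yU xU eyx.
    by have [_ ->] := ecross _ _ yU zU eyz; rewrite eqxx /= ?orbT.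
  + have [_ ->] := ecross _ _ zU xU ezx.
    by have [_ ->] := ecross _ _ zU yU ezy; rewrite eqxx /= ?orbT.
  + by rewrite !bU' //; exact: tri2.
have [p1 p1P] := cob1 c c_sym c_irr; have [p2 p2P] := cob2 c c_sym c_irr.
(* The shift by [k] makes the equation hold on the new tree edge between [R] and [R']. *)
pose k := p1 R (+) p2 R' (+) c R R'.
exists (fun B : {set V} => if B \subset U then p1 B else p2 B (+) k).
have sbU v : v \in U -> b v \subset U by move=> vU; rewrite bU //; case: (b1U v vU).
have cross u v : u \in U -> v \in U' -> e u v ->
    p1 (b u) (+) (p2 (b v) (+) k) = c (b u) (b v).
  move=> uU vU' /(ecross _ _ uU vU')[-> ->]; rewrite /k.
  by case: (p1 R) (p2 R') (c _ _) => [] [] [].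
move=> u v /setUP[]uU /setUP[]vU euv; rewrite ?(sb _ uU) ?(sb _ vU) ?sbU //.
- by rewrite !bU // p1P.
- exact: cross.
- by rewrite addbC c_sym cross // e_sym.
by rewrite addbACA addbb addbF !bU' // p2P.
Qed.

Lemma subset_pad (A B : {set V}) m : A \subset B -> #|A| <= m <= #|B| ->
  exists C : {set V}, [/\ A \subset C, C \subset B & #|C| = m].
Proof.
move=> AB /andP[Am mB]; have [|C /minsetP[/and3P[AC CB mC] minC]] :=
  @ex_minset V (fun C => [&& A \subset C, C \subset B & m <= #|C|]).
  by exists B; rewrite AB subxx.
exists C; split=> //; apply/eqP; rewrite eqn_leq mC andbT leqNgt; apply/negP => ltmC.
have [x xC xA] : exists2 x, x \in C & x \notin A.
  by apply/subsetPn/negP => /subset_leq_card; lia.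
have := cardsD1 x C; rewrite xC => cC.
have CxC : C :\ x \subset C by exact: subD1set.
have : C :\ x = C.
  apply: minC => //; rewrite (subset_trans CxC CB) subsetD1 AC xA /=; lia.
by move/setP/(_ x); rewrite !inE xC eqxx.
Qed.

(** * Existence of tree-partitions, from balanced separators *)

Variables (k d : nat) (U0 : {set V}).
Hypothesis k_gt0 : 0 < k.
Hypothesis d_gt0 : 0 < d.
Hypothesis e_deg : forall u, #|[set v | e u v]| <= d.
Hypothesis separator : forall U S : {set V},
  U \subset U0 -> S \subset U -> 3 * k <= 2 * #|S| ->
  exists X P : {set V}, [/\ #|X| <= k, P \subset U :\: X,
    forall u v, u \in P -> v \in U -> v \notin X -> e u v -> v \in P,
    #|S| <= 3 * #|S :&: P| & 6 * #|S :&: P| <= 5 * #|S|].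

(** Twice the bound [24 * k * d] kept on [S] below, since a root bag is at most twice as large as
    [S]. *)
Let w := 48 * k * d.

Lemma card_neighbours (S : {set V}) : #|\bigcup_(u in S) [set v | e u v]| <= #|S| * d.
Proof.
rewrite -sum_nat_const; elim/big_rec2: _ => [|u n B _ leBn]; first by rewrite cards0.
by rewrite (leq_trans (leq_card_setU _ _)) // leq_add.
Qed.

(* A separator adds at most 2k to the total size of [S] over the two parts; the
   summand 4k compensates for this when the two root bags are merged. *)
Lemma tree_partition_rooted n (U S : {set V}) :
  #|U| <= n -> U \subset U0 -> S \subset U -> 4 * k <= #|S| <= 24 * k * d ->
  exists R : {set V}, [/\ S \subset R, tree_partition w U R & #|R| + 4 * k <= 2 * #|S|].
Proof.
elim: n U S => [|n IH] U S leUn UU0 SU /andP[geS leS].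
  by have := subset_leq_card SU; lia.
(* A small [S] is itself the root bag; its neighbours must then lie in the root bag of the rest. *)
have [smallS|bigS] := leqP #|S| (24 * k).
  exists S; split; [by []| |by lia].
  pose N := (U :\: S) :&: \bigcup_(u in S) [set v | e u v].
  have leN : #|N| <= 24 * k * d.
    rewrite (leq_trans (subset_leq_card (subsetIr _ _))) //.
    by rewrite (leq_trans (card_neighbours S)) // leq_mul2r smallS orbT.
  have [R' [NR' tpR' leR']] : exists R' : {set V}, [/\ N \subset R',
      tree_partition w (U :\: S) R' & #|R'| <= w].
    have [smallU|bigU] := leqP #|U :\: S| (4 * k).
      exists (U :\: S); split; [exact: subsetIl|exact: TProot|].
      by rewrite (leq_trans smallU) // /w; nia.
    have leNU : #|N| <= #|U :\: S| by apply/subset_leq_card/subsetIl.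
    (* [N] is padded to the minimal size [4 * k] that the induction hypothesis requires. *)
    have [|C [NC CU cC]] := @subset_pad N (U :\: S) (maxn (4 * k) #|N|) (subsetIl _ _).
      by lia.
    have ltUS : #|U :\: S| <= n.
      by have := cardsD U S; rewrite (setIidPr SU); have := subset_leq_card SU; lia.
    have [||R' [CR' tpR' leR']] := IH _ C ltUS _ CU.
    - by rewrite (subset_trans (subsetDl _ _)).
    - by rewrite cC; nia.
    exists R'; split=> //; first exact: subset_trans CR'.
    by rewrite cC in leR'; rewrite /w; nia.
  have -> : U = S :|: (U :\: S) by rewrite setDE setUIr setUCr setIT (setUidPr SU).
  apply: TPattach tpR' leR' _ _; first exact: TProot.
    by rewrite -setI_eq0 setIDA setIC setDIl setDv setI0.
  move=> u v uS vU euv; split=> //; apply: (subsetP NR'); rewrite inE vU.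
  by apply/bigcupP; exists u; rewrite ?inE.
(* As [#|S|] exceeds [24 * k], each side receives more than [4 * k] vertices of [S], and five sixths
   of [S] plus [k] is still at most [#|S|]. *)
have [|X [P [leX PU eP leSP geSP]]] := separator UU0 SU; first by lia.
have [PsU PX] : P \subset U /\ [disjoint P & X] by apply/andP; rewrite -subsetD.
(* The separator goes into both parts and into both new sets [S], so the two partitions overlap only
   in their root bags. *)
pose Y := X :&: U.
have leY : #|Y| <= k by rewrite (leq_trans (subset_leq_card (subsetIl _ _))).
have cSP := cardsID P S.
have leS1 := (leq_card_setU (S :&: P) Y).1.
have leS2 := (leq_card_setU (S :\: P) Y).1.
have geS1 : #|S :&: P| <= #|(S :&: P) :|: Y| by exact/subset_leq_card/subsetUl.
have geS2 : #|S :\: P| <= #|(S :\: P) :|: Y| by exact/subset_leq_card/subsetUl.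
have YU : Y \subset U by exact: subsetIr.
have U1U : P :|: Y \subset U by rewrite subUset PsU.
have U2U : U :\: P \subset U by exact: subsetDl.
have ltU1 : #|P :|: Y| < #|U|.
  apply/proper_card; rewrite properE U1U /=; apply/negP => sU.
  have : S :\: P \subset Y.
    apply/subsetP => x; rewrite inE => /andP[xP xS].
    by have := subsetP sU x (subsetP SU x xS); rewrite inE (negPf xP).
  by move/subset_leq_card; lia.
have ltU2 : #|U :\: P| < #|U|.
  apply/proper_card; rewrite properE U2U /=; apply/negP => sU.
  have : S :&: P \subset set0.
    apply/subsetP => x; rewrite inE => /andP[xS xP].
    by have := subsetP sU x (subsetP SU x xS); rewrite inE xP.
  by move/subset_leq_card; rewrite cards0; lia.
have [||||R1 [SR1 tp1 leR1]] := IH (P :|: Y) ((S :&: P) :|: Y).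
- by rewrite -ltnS (leq_trans ltU1).
- exact: subset_trans UU0.
- by rewrite setSU // subsetIr.
- by apply/andP; split; lia.
have [||||R2 [SR2 tp2 leR2]] := IH (U :\: P) ((S :\: P) :|: Y).
- by rewrite -ltnS (leq_trans ltU2).
- exact: subset_trans UU0.
- rewrite subUset setSD //= subsetD YU /=.
  by rewrite disjoint_sym; apply: disjointWr PX; exact: subsetIl.
- by apply/andP; split; lia.
exists (R1 :|: R2); split.
- apply/subsetP => x xS; rewrite inE; have [xP|xP] := boolP (x \in P).
    by rewrite (subsetP SR1) // !inE xS xP.
  by rewrite (subsetP SR2) ?orbT // !inE xS xP.
- have -> : U = (P :|: Y) :|: (U :\: P).
    apply/setP => x; rewrite !inE; case: (boolP (x \in P)) => [/(subsetP PsU)->|] //= _.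
    by case: (x \in U); rewrite ?andbF ?orbT.
  apply: tree_partition_merge => // [x|u v].
    rewrite !inE => /orP[->//|/andP[xX xU]] /andP[xP _].
    by rewrite (subsetP SR1) ?(subsetP SR2) // !inE xX xU orbT.
  rewrite !inE => /orP[uP|/andP[uX uU]] /andP[vP vU] euv.
    right; have [vX|vX] := boolP (v \in X); first by rewrite vU orbT.
    by rewrite (eP u v).
  by left; rewrite uU andbT; apply/negP => /(disjointFr PX); rewrite uX.
by have := (leq_card_setU R1 R2).1; lia.
Qed.

Lemma tree_partition_exists : exists R, tree_partition w U0 R /\ #|R| <= w.
Proof.
have [smallU|bigU] := leqP #|U0| (4 * k).
  by exists U0; split; [exact: TProot|rewrite (leq_trans smallU) // /w; nia].
have [|S [_ SU cS]] := @subset_pad set0 U0 (4 * k) (sub0set _).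
  by rewrite cards0; lia.
have [|R [_ tpR leR]] := tree_partition_rooted (leqnn _) (subxx _) SU.
  by rewrite cS; nia.
by exists R; split=> //; rewrite /w; nia.
Qed.

End TreePartition.

(** * Balanced separators in tree decompositions *)

Section BalancedNode.
Variables (T : finType) (a : rel T).
Hypothesis a_sym : symmetric a.
Hypothesis a_irr : irreflexive a.
Hypothesis a_connected : forall x y, connect a x y.
Hypothesis a_acyclic : forall c : seq T, uniq c -> 2 < size c -> ~~ cycle a c.

Definition without (t : T) : rel T := fun x y => [&& a x y, x != t & y != t].

Lemma without_sym t : connect_sym (without t).
Proof. by apply: sym_connect_sym => x y; rewrite /without a_sym [(x != t) && _]andbC. Qed.

Lemma path_without t x p : path a x p -> t \notin x :: p -> path (without t) x p.
Proof.
elim: p x => //= y p IH x /andP[axy pP]; rewrite !inE !negb_or => /and3P[tx ty tp].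
by rewrite /without axy eq_sym tx eq_sym ty /= IH // inE negb_or ty.
Qed.

(** Otherwise the two paths to [z] would join [s] to [t] without the edge between them, and this
    edge would close a cycle. *)
Lemma edge_is_bridge s t z : a s t ->
  connect (without t) s z -> ~~ connect (without s) t z.
Proof.
move=> ast cs; apply/negP => ct.
pose a' x y := a x y && ((x, y) \notin [:: (s, t); (t, s)]).
have : connect a' s t.
  apply: (connect_trans (y := z)).
    apply: connect_sub cs => x y /and3P[axy xt yt]; apply: connect1.
    by rewrite /a' axy !inE !xpair_eqE negb_or (negPf xt) (negPf yt) andbF.
  rewrite without_sym in ct; apply: connect_sub ct => x y /and3P[axy xs ys].
  apply: connect1; rewrite /a' axy !inE !xpair_eqE negb_or (negPf xs) (negPf ys).
  by rewrite andbF.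
case/connectP=> p0 p0P; case/shortenP: p0P => p pP up _ tl.
have pa : path a s p by apply: sub_path pP => x y /andP[].
case: p tl pP up pa => [|y [|x p]] tl pP up pa.
- by move: ast; rewrite tl a_irr.
- by move: pP; rewrite /= in tl; rewrite /= /a' -tl inE eqxx andbF.
have /negP := a_acyclic up isT; apply.
by rewrite /cycle rcons_path pa -tl a_sym.
Qed.

Lemma connect_first_step t c : c != t ->
  exists2 t', a t t' & connect (without t) t' c.
Proof.
move=> ct; case/connectP: (a_connected t c) => p0 p0P.
case/shortenP: p0P => -[|t' p] /= pP up _ cl; first by rewrite cl eqxx in ct.
case/andP: pP => att' pP; case/andP: up => tp _.
by exists t' => //; apply/connectP; exists p => //; exact: path_without.
Qed.

Lemma connect_without_avoid s t x y :
  connect (without s) x y -> ~~ connect (without s) x t -> connect (without t) x y.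
Proof.
case/connectP=> p pP -> xt; apply/connectP; exists p => //; apply: path_without.
  by apply: sub_path pP => u v /and3P[].
by apply/negP => tp; case/negP: xt; exact: (path_connect pP).
Qed.

Lemma connect_without_neq t x y : x != t -> connect (without t) x y -> y != t.
Proof.
move=> xt; rewrite without_sym => /connectP[[|z p] /=]; first by move=> _ <-.
by case/andP=> /and3P[].
Qed.

Variables (V : finType) (Z : T -> {set V}) (S : {set V}) (node : V -> T).
Hypothesis nodeP : forall v, v \in S -> v \in Z (node v).

Definition branch (t c : T) : {set V} :=
  [set v in S | (v \notin Z t) && connect (without t) c (node v)].

(* Otherwise every node [t] has a heavy branch. Step from [t] into its heavy
   branch: by [edge_is_bridge] the heavy branch at the new node is smaller,
   unless it points back to [t], and then the two heavy branches are disjoint. *)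
Lemma balanced_node (t0 : T) : exists t, forall c, 2 * #|branch t c| <= #|S|.
Proof.
case: (boolP [exists t, [forall c, 2 * #|branch t c| <= #|S|]]).
  by case/existsP=> t /forallP; exists t.
rewrite negb_exists => /forallP heavy.
have {}heavy t : exists c, #|S| < 2 * #|branch t c|.
  have := heavy t; rewrite negb_forall => /existsP[c]; rewrite -ltnNge.
  by exists c.
(* A vertex whose node is [t] lies in [Z t], so [branch t t] is empty. *)
have neq t c : #|S| < 2 * #|branch t c| -> c != t.
  move=> h; apply: contraTneq h => ->; rewrite -leqNgt.
  suff -> : branch t t = set0 by rewrite cards0.
  apply/setP => v; rewrite !inE; apply/negP => /and3P[vS vZ].
  case/connectP=> -[|y p] /=; last by rewrite /without eqxx andbF.
  by move=> _ tn; have := nodeP vS; rewrite tn (negPf vZ).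
suff : forall n t c, #|[set x | connect (without t) c x]| <= n ->
    ~ #|S| < 2 * #|branch t c|.
  by move=> H; have [c /(H _ _ _ (leqnn _))] := heavy t0.
elim=> [|n IH] t c len h.
  by move: len; rewrite leqn0 cards_eq0 => /eqP/setP/(_ c); rewrite !inE connect0.
have ct := neq _ _ h.
have [t' att' ct'c] := connect_first_step ct.
have [c' h'] := heavy t'; have c't' := neq _ _ h'.
have cct' : connect (without t) c t' by rewrite without_sym.
have [c't|c't] := boolP (connect (without t') c' t).
  have : branch t c :&: branch t' c' = set0.
    apply/setP => v; rewrite !inE; apply/negP.
    case/andP=> /and3P[_ _ cv] /and3P[_ _ c'v].
    have t'v := connect_trans ct'c cv.
    have tv : connect (without t') t (node v).
      by apply: connect_trans c'v; rewrite without_sym.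
    by have /negP := edge_is_bridge att' tv.
  have : branch t c :|: branch t' c' \subset S.
    by apply/subsetP => v; rewrite !inE => /orP[]/and3P[].
  move=> /subset_leq_card sS dis; have := cardsUI (branch t c) (branch t' c').
  by rewrite dis cards0 addn0; lia.
apply: (IH t' c') => //; rewrite -ltnS (leq_trans _ len) //.
have [y at'y yc'] := connect_first_step c't'.
apply/proper_card/properP; split; last first.
  exists t'; rewrite !inE //; apply/negP => c't'c.
  by have := connect_without_neq c't' c't'c; rewrite eqxx.
apply/subsetP => x; rewrite !inE => c'x.
have yt : ~~ connect (without t') y t.
  by apply: contra c't; apply: connect_trans; rewrite without_sym.
apply: connect_trans cct' (connect_trans _ (connect_without_avoid (connect_trans yc' c'x) yt)).
apply: connect1; rewrite /without at'y /=.
have -> : t' != t by apply: contraTneq att' => ->; rewrite a_irr.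
by apply: contraNneq yt => ->; exact: connect0.
Qed.

End BalancedNode.

Section Separator.
Variables (T : finType) (a : rel T).
Hypothesis a_sym : symmetric a.
Hypothesis a_irr : irreflexive a.
Hypothesis a_connected : forall x y, connect a x y.
Hypothesis a_acyclic : forall c : seq T, uniq c -> 2 < size c -> ~~ cycle a c.
Variables (V : finType) (e : rel V) (U0 : {set V}) (Z : T -> {set V}).
Variables (k : nat) (t0 : T).
Hypothesis Z_card : forall t, #|Z t| <= k.
Hypothesis Z_node : forall v, v \in U0 -> exists t, v \in Z t.
Hypothesis Z_edge : forall u v, u \in U0 -> v \in U0 -> e u v ->
  exists t, u \in Z t /\ v \in Z t.
Hypothesis Z_subtree : forall v s s', v \in U0 -> v \in Z s -> v \in Z s' ->
  connect (fun x y => [&& a x y, v \in Z x & v \in Z y]) s s'.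

(** [X] is the bag of a balanced node [t], and [P] comes from a minimal family [J] of components of
    the tree minus [t] that carries a third of [S]. Dropping one component, which holds at most half
    of [S], leaves less than a third; hence the bound 1/3 + 1/2 = 5/6. *)
Lemma balanced_separator (U S : {set V}) :
  U \subset U0 -> S \subset U -> 3 * k <= 2 * #|S| ->
  exists X P : {set V}, [/\ #|X| <= k, P \subset U :\: X,
    forall u v, u \in P -> v \in U -> v \notin X -> e u v -> v \in P,
    #|S| <= 3 * #|S :&: P| & 6 * #|S :&: P| <= 5 * #|S|].
Proof.
move=> UU0 SU leS; pose node v := odflt t0 [pick t | v \in Z t].
have nodeP v : v \in U0 -> v \in Z (node v).
  move=> /Z_node[t vt]; rewrite /node; case: pickP => //= /(_ t).
  by rewrite vt.
have [v vS|t branchP] :=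
  @balanced_node T a a_sym a_irr a_connected a_acyclic V Z S node _ t0.
  by apply/nodeP/(subsetP UU0)/(subsetP SU).
(* The subtree of [v] avoids [t], hence stays in one component. *)
have node_conn v s : v \in U0 -> v \notin Z t -> v \in Z s ->
    connect (without a t) (node v) s.
  move=> vU vt vs; apply: connect_sub (Z_subtree vU (nodeP v vU) vs).
  move=> x y /and3P[axy vx vy]; apply: connect1; rewrite /without axy /=.
  by apply/andP; split; apply: contraNneq vt => <-.
pose side (J : {set T}) :=
  [set v in U | (v \notin Z t) && (fingraph.root (without a t) (node v) \in J)].
have [|J /minsetP[leJ minJ]] :=
  @ex_minset T (fun J => #|S| <= 3 * #|S :&: side J|).
  (* All components together miss only [Z t], which contains at most two thirds of [S]. *)
  exists setT; have -> : S :&: side setT = S :\: Z t.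
    apply/setP => v; rewrite !inE andbT; case vS: (v \in S); rewrite ?andbF //=.
    by rewrite (subsetP SU) // andbT.
  have := cardsID (Z t) S; have := Z_card t.
  by have := subset_leq_card (subsetIr S (Z t)); lia.
exists (Z t), (side J); split=> // [|u v|].
- by apply/subsetP => v; rewrite !inE => /and3P[-> ->].
- rewrite !inE => /and3P[uU ut uJ] vU vt euv; rewrite vU vt /=.
  have uU0 := subsetP UU0 u uU; have vU0 := subsetP UU0 v vU.
  have [s [us vs]] := Z_edge uU0 vU0 euv.
  suff <- : fingraph.root (without a t) (node u) = fingraph.root (without a t) (node v) by [].
  have csym := without_sym a_sym t; apply/fingraph.rootP => //.
  apply: connect_trans (node_conn u s uU0 ut us) _.
  by rewrite csym; exact: node_conn.
have [J0|[c cJ]] := set_0Vmem J.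
  suff -> : side J = set0 by rewrite setI0 cards0; lia.
  by apply/setP => v; rewrite J0 !inE !andbF.
have : ~~ (#|S| <= 3 * #|S :&: side (J :\ c)|).
  apply/negP => /minJ/(_ (subD1set _ _))/setP/(_ c).
  by rewrite !inE eqxx cJ.
rewrite -ltnNge => ltc; have := branchP c.
have : S :&: side J \subset (S :&: side (J :\ c)) :|: branch a Z S node t c.
  apply/subsetP => v; rewrite !inE => /and4P[vS vU vt vJ]; rewrite vS vU vt vJ /=.
  case: eqP => //= <-; rewrite without_sym // connect_root //.
move/subset_leq_card; have := (leq_card_setU (S :&: side (J :\ c)) (branch a Z S node t c)).1.
lia.
Qed.

End Separator.

(** * From tree-width to tree-partitions *)

Lemma connect_induced (G : sgraph) (S : {set G}) (x y : induced S) :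
  connect (@adj (induced S)) x y ->
  connect (fun u v => [&& @adj G u v, u \in S & v \in S]) (val x) (val y).
Proof.
case/connectP=> p; elim: p x => [|z p IH] x /= => [_ ->|]; first exact: connect0.
case/andP=> xz /IH h /h; apply: connect_trans; apply: connect1.
by rewrite (valP x) (valP z) !andbT.
Qed.

(** An optimal tree decomposition has bags of at most [t.+1] vertices, which serve as the
    separators, with [k = t.+1]. *)
Lemma tw_tree_partition (G : sgraph) (A : {set G}) (t d : nat) :
  0 < d -> (forall u : G, #|[set v | adj u v]| <= d) ->
  (tw (del_vertices A) <= t%:Z)%R ->
  exists R, tree_partition (@adj G) (48 * t.+1 * d) (~: A) R /\
            #|R| <= 48 * t.+1 * d.
Proof.
move=> d_gt0 deg twA; have [[D wD] _] := twP (del_vertices A).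
have maxD : max_bag D <= t.+1 by move: twA; rewrite -wD /width; lia.
have [[T_gt0 T_conn] T_acyclic] := td_treeP D.
have /card_gt0P[t0 _] := T_gt0.
pose Z (s : td_tree D) : {set G} := [set val x | x in td_bag s].
have ZE s (v : del_vertices A) : (val v \in Z s) = (v \in td_bag s).
  by rewrite mem_imset //; exact: val_inj.
have ex v : v \in ~: A -> exists v' : del_vertices A, val v' = v.
  by move=> vA; exists (exist _ v vA).
apply: tree_partition_exists => //; first exact: adj_sym.
apply: (balanced_separator (@adj_sym _) (@adj_irr _) T_conn T_acyclic (Z := Z)) t0 _ _ _ _.
- move=> s; rewrite card_imset; last exact: val_inj.
  by apply: leq_trans maxD; rewrite /max_bag (bigD1 s) //= leq_maxl.
- move=> v /ex[v' <-]; have [/card_gt0P[s _] _] := td_subtree D v'.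
  by exists (val s); rewrite ZE; have := valP s; rewrite inE.
- move=> u v /ex[u' <-] /ex[v' <-] euv.
  have [s [us vs]] := @td_edge _ D u' v' euv.
  by exists s; rewrite !ZE.
move=> v s s' /ex[v' <-]; rewrite !ZE => vs vs'.
have [_ conn] := td_subtree D v'.
have sP : s \in [set r | v' \in td_bag r] by rewrite inE.
have sP' : s' \in [set r | v' \in td_bag r] by rewrite inE.
have := connect_induced (conn (exist _ s sP) (exist _ s' sP')).
apply: connect_sub => x y; rewrite !inE => /and3P[axy vx vy]; apply: connect1.
by rewrite axy !ZE vx vy.
Qed.

(** * Stokes' formula modulo 2 for the triangulated cube *)

Local Notation "\xor_ ( i < n ) F" := (\big[addb/false]_(i < n) F)
  (at level 41, F at level 41, i, n at level 50).

Lemma xor_telescope (h : nat -> bool) n :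
  \xor_(i < n) (h i (+) h i.+1) = h 0 (+) h n.
Proof.
elim: n => [|n IH]; first by rewrite big_ord0 addbb.
by rewrite big_ord_recr IH /= addbA -(addbA (h 0)) addbb addbF.
Qed.

Section Square.
Variables (V : Type) (v : nat -> nat -> V) (h : V -> V -> bool).

(** The coboundary of [h] modulo 2; [boundary3] is the analogue one dimension higher. *)
Definition boundary2 (a b c : V) : bool := h b c (+) h a c (+) h a b.

(** The diagonal of each unit square occurs twice and cancels; the other edges telescope. *)
Lemma stokes_square n :
  \xor_(x < n) \xor_(y < n)
    (boundary2 (v x y) (v x.+1 y) (v x.+1 y.+1) (+)
     boundary2 (v x y) (v x y.+1) (v x.+1 y.+1)) =
  \xor_(y < n) (h (v 0 y) (v 0 y.+1) (+) h (v n y) (v n y.+1)) (+)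
  \xor_(x < n) (h (v x 0) (v x.+1 0) (+) h (v x n) (v x.+1 n)).
Proof.
pose hx x y := h (v x y) (v x.+1 y); pose hy x y := h (v x y) (v x y.+1).
transitivity (\xor_(x < n) (\xor_(y < n) (hy x y (+) hy x.+1 y) (+)
                            \xor_(y < n) (hx x y (+) hx x y.+1))).
  apply: eq_bigr => x _; rewrite -big_split; apply: eq_bigr => y _ /=.
  rewrite /boundary2 /hx /hy; move: (h (v x y) (v x.+1 y.+1)) (h (v x y) (v x.+1 y)).
  by move: (h _ _) (h _ _) (h _ _) => [] [] [] [] [].
rewrite big_split exchange_big /=; congr (_ (+) _).
  by apply: eq_bigr => y _; exact: (xor_telescope (hy^~ y)).
by apply: eq_bigr => x _; exact: (xor_telescope (hx x)).
Qed.

End Square.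

Section Cube.
Variables (V : Type) (v : nat -> nat -> nat -> V) (g : V -> V -> V -> bool).

Definition boundary3 (a b c d : V) : bool :=
  g b c d (+) g a c d (+) g a b d (+) g a b c.

Definition square (a b c d : V) : bool := g a b d (+) g a c d.

Definition face_x x y z :=
  square (v x y z) (v x y.+1 z) (v x y z.+1) (v x y.+1 z.+1).
Definition face_y x y z :=
  square (v x y z) (v x.+1 y z) (v x y z.+1) (v x.+1 y z.+1).
Definition face_z x y z :=
  square (v x y z) (v x.+1 y z) (v x y.+1 z) (v x.+1 y.+1 z).

(** Kuhn's triangulation: the six tetrahedra are the monotone paths between opposite corners. On
    grid points they are cliques of [Q n]. *)
Definition cell x y z :=
  let p100 := v x.+1 y z in let p010 := v x y.+1 z in let p001 := v x y z.+1 in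
  let p110 := v x.+1 y.+1 z in let p101 := v x.+1 y z.+1 in
  let p011 := v x y.+1 z.+1 in
  let tet q r := boundary3 (v x y z) q r (v x.+1 y.+1 z.+1) in
  tet p100 p110 (+) tet p100 p101 (+) tet p010 p110 (+) tet p010 p011 (+)
  tet p001 p101 (+) tet p001 p011.

Lemma cell_faces x y z :
  cell x y z = (face_x x y z (+) face_x x.+1 y z) (+)
               (face_y x y z (+) face_y x y.+1 z) (+)
               (face_z x y z (+) face_z x y z.+1).
Proof.
pose p := v x y z; pose q := v x.+1 y.+1 z.+1.
(* Each triangle containing the diagonal pq lies in two tetrahedra of the cell. *)
pose diag := g p (v x.+1 y z) q (+) g p (v x y.+1 z) q (+) g p (v x y z.+1) q (+)
  g p (v x.+1 y.+1 z) q (+) g p (v x.+1 y z.+1) q (+) g p (v x y.+1 z.+1) q.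
rewrite -[RHS]addbF -(addbb diag) /diag /cell /face_x /face_y /face_z /square.
rewrite /boundary3 -/p -/q.
have xorE a b : a (+) b = (a + b)%R by [].
by rewrite !xorE; ring.
Qed.

Lemma stokes_cube n :
  \xor_(x < n) \xor_(y < n) \xor_(z < n) cell x y z =
  \xor_(y < n) \xor_(z < n) (face_x 0 y z (+) face_x n y z) (+)
  \xor_(x < n) \xor_(z < n) (face_y x 0 z (+) face_y x n z) (+)
  \xor_(x < n) \xor_(y < n) (face_z x y 0 (+) face_z x y n).
Proof.
pose fx x y z := face_x x y z (+) face_x x.+1 y z.
pose fy x y z := face_y x y z (+) face_y x y.+1 z.
pose fz x y z := face_z x y z (+) face_z x y z.+1.
transitivity (\xor_(x < n) (\xor_(y < n) \xor_(z < n) fx x y z (+)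
  \xor_(y < n) \xor_(z < n) fy x y z (+) \xor_(y < n) \xor_(z < n) fz x y z)).
  apply: eq_bigr => x _; rewrite -!big_split; apply: eq_bigr => y _ /=.
  by rewrite -!big_split; apply: eq_bigr => z _; exact: cell_faces.
rewrite !big_split /=; congr (_ (+) _ (+) _).
- rewrite exchange_big; apply: eq_bigr => y _; rewrite exchange_big.
  by apply: eq_bigr => z _; exact: (xor_telescope (fun x => face_x x y z)).
- apply: eq_bigr => x _; rewrite exchange_big.
  by apply: eq_bigr => z _; exact: (xor_telescope (fun y => face_y x y z)).
apply: eq_bigr => x _; apply: eq_bigr => y _.
exact: (xor_telescope (face_z x y)).
Qed.

End Cube.

(** * The Sperner argument *)

(* The nesting mirrors [lab] below: [None] for small x, [Some None] for large x
   and small y, [Some (Some b)] for large x and y, where [b] tells small z. *)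
Notation label := (option (option bool)).

Definition full (l0 l1 l2 l3 : label) : bool := uniq [:: l0; l1; l2; l3].

Definition door (l0 l1 l2 : label) : bool :=
  uniq [:: l0; l1; l2] && (None \notin [:: l0; l1; l2]).

Definition door_edge (l0 l1 : label) : bool :=
  [&& l0 != l1, Some None \notin [:: l0; l1] & None \notin [:: l0; l1]].

(** Sperner's parity step: a full tetrahedron has exactly one door, any other has none or two. *)
Lemma boundary_door l0 l1 l2 l3 : boundary3 door l0 l1 l2 l3 = full l0 l1 l2 l3.
Proof.
by case: l0 => [[[]|]|]; case: l1 => [[[]|]|]; case: l2 => [[[]|]|];
   case: l3 => [[[]|]|].
Qed.

Lemma boundary_door_edge l0 l1 l2 : None \notin [:: l0; l1; l2] ->
  boundary2 door_edge l0 l1 l2 = door l0 l1 l2.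
Proof. by case: l0 => [[[]|]|]; case: l1 => [[[]|]|]; case: l2 => [[[]|]|]. Qed.

Lemma full_mem l l0 l1 l2 l3 : full l0 l1 l2 l3 -> l \in [:: l0; l1; l2; l3].
Proof.
by case: l => [[[]|]|]; case: l0 => [[[]|]|]; case: l1 => [[[]|]|];
   case: l2 => [[[]|]|]; case: l3 => [[[]|]|].
Qed.

Lemma full_swap01 l0 l1 l2 l3 : full l1 l0 l2 l3 = full l0 l1 l2 l3.
Proof. by apply: perm_uniq; rewrite -(cat1s l1) -(cat1s l0) perm_catCA. Qed.

Lemma full_swap12 l0 l1 l2 l3 : full l0 l2 l1 l3 = full l0 l1 l2 l3.
Proof. by apply: perm_uniq; rewrite perm_cons -(cat1s l1) -(cat1s l2) perm_catCA. Qed.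

Lemma full_swap23 l0 l1 l2 l3 : full l0 l1 l3 l2 = full l0 l1 l2 l3.
Proof. by apply: perm_uniq; rewrite !perm_cons -(cat1s l3) -(cat1s l2) perm_catC. Qed.

(** Distance at most [r] in the maximum norm, written without truncated subtraction. *)
Definition near n (r : nat) : rel ('I_n * 'I_n * 'I_n) := fun p q =>
  [&& p.1.1 <= q.1.1 + r <= p.1.1 + r + r, p.1.2 <= q.1.2 + r <= p.1.2 + r + r
    & p.2 <= q.2 + r <= p.2 + r + r].

Lemma near_sym n r : symmetric (@near n r).
Proof. by move=> p q; rewrite /near; lia. Qed.

Lemma near_refl n r : reflexive (@near n r).
Proof. by move=> p; rewrite /near; lia. Qed.

Lemma near_trans n r s (p q t : 'I_n * 'I_n * 'I_n) :
  near r p q -> near s q t -> near (r + s) p t.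
Proof. by rewrite /near; lia. Qed.

Lemma near_le n r s (p q : 'I_n * 'I_n * 'I_n) : r <= s -> near r p q -> near s p q.
Proof. by rewrite /near; lia. Qed.

Lemma Q_adj_near n (p q : 'I_n * 'I_n * 'I_n) : Q_adj p q -> near 1 p q.
Proof. by rewrite /Q_adj /Q_step /near => /andP[_]; lia. Qed.

Section Label.
Variable m : nat.
Local Notation I := 'I_(2 * m).+1.
Local Notation V := (I * I * I)%type.

Definition lab (p : V) : label :=
  if p.1.1 < m then None else if p.1.2 < m then Some None else Some (Some (p.2 < m)).

Definition center : V := (inord m, inord m, inord m).

(* The four label regions meet only at the center. *)
Lemma full_near_center r (p0 p1 p2 p3 : V) :
  {in [:: p0; p1; p2; p3] &, forall p q, near r p q} ->
  full (lab p0) (lab p1) (lab p2) (lab p3) ->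
  {in [:: p0; p1; p2; p3], forall p, near r p center}.
Proof.
move=> nr fl p ps.
have ex l : exists q, near r p q /\ lab q = l.
  have : l \in map lab [:: p0; p1; p2; p3] by exact: full_mem.
  by case/mapP=> q qs ->; exists q; split=> //; exact: nr.
have [q1 [/and3P[? ? ?] l1]] := ex None.
have [q2 [/and3P[? ? ?] l2]] := ex (Some None).
have [q3 [/and3P[? ? ?] l3]] := ex (Some (Some true)).
have [q0 [/and3P[? ? ?] l0]] := ex (Some (Some false)).
have [? ? ?] : [/\ m <= q0.1.1, m <= q0.1.2 & m <= q0.2].
  by move: l0; rewrite /lab; case: ltnP => // ?; case: ltnP => // ?; case: ltnP.
have [? ? ?] : [/\ m <= q3.1.1, m <= q3.1.2 & q3.2 < m].
  by move: l3; rewrite /lab; case: ltnP => // ?; case: ltnP => // ?; case: ltnP.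
have [? ?] : m <= q2.1.1 /\ q2.1.2 < m.
  by move: l2; rewrite /lab; case: ltnP => // ?; case: ltnP.
have ? : q1.1.1 < m.
  by move: l1; rewrite /lab; case: ltnP => // ?; case: ltnP.
by apply/and3P; rewrite /= inordK; last lia; split; lia.
Qed.

Variables (A : {set V}) (rep : V -> V) (D : nat).
Local Notation e := (@Q_adj (2 * m).+1).
Local Notation lrep := (lab \o rep).

Hypothesis m_large : 3 * D + 2 < m.
Hypothesis rep_near : forall v, near D v (rep v).
Hypothesis triangle_A : forall x y z, x \in A -> y \in A -> z \in A ->
  e x y -> e x z -> e y z -> [|| rep x == rep y, rep x == rep z | rep y == rep z].
Hypothesis triangle_B : forall x y z, x \notin A -> y \notin A -> z \notin A ->
  e x y -> e x z -> e y z -> [|| rep x == rep y, rep x == rep z | rep y == rep z].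

(** For a pair [E] of representatives of clusters of [A], [phi E] is one side of the cut formed
    outside [A] by the edges that carry the two remaining labels. *)
Variable phi : {set V} -> V -> bool.
Hypothesis phiP : forall u u' v v', u \in A -> u' \in A -> v \notin A -> v' \notin A ->
  e u u' -> e u v -> e u v' -> e u' v -> e u' v' -> e v v' ->
  phi [set rep u; rep u'] v (+) phi [set rep u; rep u'] v' =
  full (lrep u) (lrep u') (lrep v) (lrep v').

Let central p := near (2 * D + 1) p center.

(** Restricting to central clusters makes [g] vanish at the boundary of the cube. *)
Let cross u u' v := [&& rep u != rep u', central (rep u), central (rep u') &
  phi [set rep u; rep u'] v].

Let cross_sym u u' v : cross u' u v = cross u u' v.
Proof. by rewrite /cross eq_sym setUC; case: central; case: central. Qed.

(** Supported on triangles with exactly two vertices in [A]; chosen to have the same coboundary as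
    the doors. *)
Let g x y z :=
  if x \in A then
    if y \in A then (z \notin A) && cross x y z else (z \in A) && cross x z y
  else [&& y \in A, z \in A & cross y z x].

Let rep_adj u v : e u v -> near (2 * D + 1) (rep u) (rep v).
Proof.
move=> /Q_adj_near uv; have ru := rep_near u; rewrite near_sym in ru.
have := near_trans ru (near_trans uv (rep_near v)).
by apply: near_le; lia.
Qed.

(** In a full tetrahedron all representatives are central by [full_near_center]; in any other the
    two values of [phi] agree, so the restriction to central clusters is harmless. *)
Let cross_full u u' v v' : u \in A -> u' \in A -> v \notin A -> v' \notin A ->
  e u u' -> e u v -> e u v' -> e u' v -> e u' v' -> e v v' ->
  cross u u' v (+) cross u u' v' = full (lrep u) (lrep u') (lrep v) (lrep v').
Proof.
move=> uA u'A vA v'A uu' uv uv' u'v u'v' vv'; rewrite /cross.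
have [rr|_] /= := eqVneq (rep u) (rep u').
  by rewrite /full /= rr !inE eqxx.
have rn p q : e p q -> near (2 * D + 1) (rep p) (rep q) /\ near (2 * D + 1) (rep q) (rep p).
  by move=> /rep_adj pq; rewrite [near _ (rep q) _]near_sym.
have near_all : {in [:: rep u; rep u'; rep v; rep v'] &, forall p q, near (2 * D + 1) p q}.
  have [[? ?] [? ?] [? ?]] := And3 (rn _ _ uu') (rn _ _ uv) (rn _ _ uv').
  have [[? ?] [? ?] [? ?]] := And3 (rn _ _ u'v) (rn _ _ u'v') (rn _ _ vv').
  by move=> p q; rewrite !inE => /or4P[]/eqP-> /or4P[]/eqP->; rewrite ?near_refl.
have [fl|nfl] := boolP (full (lrep u) (lrep u') (lrep v) (lrep v')).
  have cent := full_near_center near_all fl.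
  rewrite /central !cent ?inE ?eqxx ?orbT //=.
  by rewrite phiP.
rewrite -(negbTE nfl) -phiP //.
case: (central _) => //=; last by rewrite phiP // (negbTE nfl).
by case: (central _) => //=; rewrite phiP // (negbTE nfl).
Qed.

Let full_monochromatic_triangle (x y z v : V) : [|| rep x == rep y, rep x == rep z | rep y == rep z] ->
  full (lrep x) (lrep y) (lrep z) (lrep v) = false.
Proof.
by case/or3P=> /eqP E; rewrite /full /= E !inE eqxx ?orbT ?andbF.
Qed.

Let cross_triangle x y z v : [|| rep x == rep y, rep x == rep z | rep y == rep z] ->
  cross x y v (+) cross x z v (+) cross y z v = false.
Proof.
case/or3P=> /eqP E; rewrite /cross E eqxx /= ?addbF ?addbb //.
by rewrite -/(cross z y v) -/(cross y z v) cross_sym addbb.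
Qed.

(** With two vertices in [A] this is [cross_full]. Otherwise three vertices lie on one side, two of
    them share a representative and the tetrahedron is not full; the terms of [g] cancel by
    [cross_triangle] if exactly three are in [A], and are all zero in the remaining cases. *)
Let boundary_g a b c d :
  e a b -> e a c -> e a d -> e b c -> e b d -> e c d ->
  boundary3 g a b c d = full (lrep a) (lrep b) (lrep c) (lrep d).
Proof.
move=> ab ac ad bc bd cd; rewrite /boundary3 /g.
have rot x y z : x (+) y (+) z = z (+) y (+) x by rewrite addbC [x (+) y]addbC addbA.
have rev x y : e x y -> e y x by rewrite Q_adj_sym.
have [ba ca da] := And3 (rev _ _ ab) (rev _ _ ac) (rev _ _ ad).
have [cb db dc] := And3 (rev _ _ bc) (rev _ _ bd) (rev _ _ cd).
case: (boolP (a \in A)) => aA; case: (boolP (b \in A)) => bA;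
case: (boolP (c \in A)) => cA; case: (boolP (d \in A)) => dA;
rewrite /= ?addbF.
- by rewrite full_monochromatic_triangle // triangle_A.
- by rewrite rot cross_triangle ?full_monochromatic_triangle // triangle_A.
- by rewrite full_swap23 rot cross_triangle ?full_monochromatic_triangle // triangle_A.
- by rewrite addbC cross_full.
- by rewrite full_swap12 full_swap23 rot cross_triangle ?full_monochromatic_triangle // triangle_A.
- by rewrite full_swap12 addbC cross_full.
- by rewrite full_swap23 full_swap12 addbC cross_full.
- by rewrite full_swap01 full_swap12 full_swap23 full_monochromatic_triangle // triangle_B.
- by rewrite full_swap01 full_swap12 full_swap23 rot cross_triangle ?full_monochromatic_triangle // triangle_A.
- by rewrite full_swap01 full_swap12 addbC cross_full.
- by rewrite full_swap01 full_swap23 full_swap12 addbC cross_full.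
- by rewrite full_swap12 full_swap23 full_monochromatic_triangle // triangle_B.
- by rewrite full_swap12 full_swap01 full_swap23 full_swap12 addbC cross_full.
- by rewrite full_swap23 full_monochromatic_triangle // triangle_B.
- by rewrite full_monochromatic_triangle // triangle_B.
- by rewrite full_monochromatic_triangle // triangle_B.
Qed.

(** A vertex of [A] is within [D] of its central representative; a vertex outside [A] is one step
    further away. *)
Let g_central x y z : e x y -> e x z -> g x y z -> near (3 * D + 2) x center.
Proof.
have near_center u : central (rep u) -> near (3 * D + 1) u center.
  by move=> cu; apply: near_le (near_trans (rep_near u) cu); lia.
move=> xy xz; rewrite /g /cross; case: ifP => _.
  by case: ifP => _ /and4P[_ _ c1 /andP[c2 _]]; apply: near_le (near_center x _); rewrite ?c1 //; lia.
case/and5P=> _ _ _ cy _; apply: near_le (near_trans (Q_adj_near xy) (near_center y cy)).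
lia.
Qed.

Let far_g x y z : e x y -> e x z ->
  [|| x.1.1 == 0 :> nat, x.1.1 == 2 * m :> nat, x.1.2 == 0 :> nat,
      x.1.2 == 2 * m :> nat, x.2 == 0 :> nat | x.2 == 2 * m :> nat] ->
  g x y z = false.
Proof.
move=> xy xz far; apply/negP => /(g_central xy xz).
by rewrite /near /center /= inordK; lia.
Qed.

(** This and the next lemmas are Sperner's boundary conditions: they survive the contraction because
    a shift by [D] does not reach the opposite half of the cube. *)
Let lrep_None (v : V) : 2 * m <= v.1.1 + D -> None != lrep v.
Proof.
move=> vx; rewrite /= /lab; have := rep_near v; rewrite /near => ?.
by rewrite ifN; [case: ifP|lia].
Qed.

Let lrep_x0 (v : V) : v.1.1 == 0 :> nat -> lrep v = None.
Proof. by move=> vx; rewrite /= /lab; have := rep_near v; rewrite /near => ?; rewrite ifT //; lia. Qed.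

Let lrep_y0 (v : V) : v.1.2 == 0 :> nat -> forall b, lrep v != Some (Some b).
Proof.
move=> vy b; rewrite /= /lab; have := rep_near v; rewrite /near => ?; case: ifP => // _.
by rewrite ifT //; lia.
Qed.

Let lrep_yn (v : V) : v.1.2 == 2 * m :> nat -> lrep v != Some None.
Proof.
move=> vy; rewrite /= /lab; have := rep_near v; rewrite /near => ?; case: ifP => // _.
by rewrite ifN //; lia.
Qed.

Let lrep_z0 (v : V) : v.2 == 0 :> nat -> lrep v != Some (Some false).
Proof.
move=> vy; rewrite /= /lab; have := rep_near v; rewrite /near => ?; case: ifP => // _.
by case: ifP => // _; apply/eqP => -[]; lia.
Qed.

Let lrep_zn (v : V) : v.2 == 2 * m :> nat -> lrep v != Some (Some true).
Proof.
move=> vy; rewrite /= /lab; have := rep_near v; rewrite /near => ?; case: ifP => // _.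
by case: ifP => // _; apply/eqP => -[]; lia.
Qed.

Let door_avoid o l0 l1 l2 : l0 != Some o -> l1 != Some o -> l2 != Some o ->
  door l0 l1 l2 = false.
Proof.
by case: o => [[]|]; case: l0 => [[[]|]|]; case: l1 => [[[]|]|]; case: l2 => [[[]|]|].
Qed.

(** The difference of two functions with equal coboundary, hence a cocycle. *)
Let t x y z := door (lrep x) (lrep y) (lrep z) (+) g x y z.

Let boundary_t a b c d :
  e a b -> e a c -> e a d -> e b c -> e b d -> e c d -> boundary3 t a b c d = false.
Proof.
move=> ab ac ad bc bd cd.
rewrite -(addbb (full (lrep a) (lrep b) (lrep c) (lrep d))).
rewrite -{1}boundary_door -(boundary_g ab ac ad bc bd cd) /boundary3 /t.
have xorE x y : x (+) y = (x + y)%R by [].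
by rewrite !xorE; ring.
Qed.

Let vtx x y z : V := (inord x, inord y, inord z).

Let vtx_adj x y z x' y' z' : x <= x' <= x.+1 -> y <= y' <= y.+1 -> z <= z' <= z.+1 ->
  x + y + z < x' + y' + z' -> x' <= 2 * m -> y' <= 2 * m -> z' <= 2 * m ->
  e (vtx x y z) (vtx x' y' z').
Proof.
move=> hx hy hz lt lx ly lz; rewrite /Q_adj /Q_step /= !inordK; try lia.
rewrite hx hy hz orTb andbT; apply/negP => /eqP[].
move/(congr1 (@nat_of_ord _)); rewrite !inordK; try lia; move=> ex.
move/(congr1 (@nat_of_ord _)); rewrite !inordK; try lia; move=> ey.
move/(congr1 (@nat_of_ord _)); rewrite !inordK; lia.
Qed.

Let N := 2 * m.

Let cell_t x y z : x < N -> y < N -> z < N -> cell vtx t x y z = false.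
Proof.
rewrite /N => ? ? ?.
by rewrite /cell /= !boundary_t //; apply: vtx_adj; lia.
Qed.

Let square_t o a b c d : e a b -> e a c -> e a d ->
  [|| a.1.1 == 0 :> nat, a.1.2 == 0 :> nat, a.1.2 == N :> nat, a.2 == 0 :> nat
    | a.2 == N :> nat] ->
  {in [:: a; b; c; d], forall v, lrep v != Some o} -> square t a b c d = false.
Proof.
move=> ab ac ad far avoid; rewrite /square /t.
rewrite !(far_g, @door_avoid o) //; try by apply: avoid; rewrite !inE eqxx ?orbT.
  by rewrite /N in far; lia.
by rewrite /N in far; lia.
Qed.

Let avoid_x0 y z : lrep (vtx 0 y z) != Some None.
Proof. by rewrite lrep_x0 //= inordK. Qed.

Let avoid_y0 b x z : lrep (vtx x 0 z) != Some (Some b).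
Proof. by apply: lrep_y0; rewrite /= inordK. Qed.

Let avoid_yn x z : lrep (vtx x N z) != Some None.
Proof. by apply: lrep_yn; rewrite /= inordK. Qed.

Let avoid_z0 x y : lrep (vtx x y 0) != Some (Some false).
Proof. by apply: lrep_z0; rewrite /= inordK. Qed.

Let avoid_zn x y : lrep (vtx x y N) != Some (Some true).
Proof. by apply: lrep_zn; rewrite /= inordK. Qed.

Let avoid_xn y z : lrep (vtx N y z) != None.
Proof. by rewrite eq_sym; apply: lrep_None; rewrite /= inordK ?leq_addr. Qed.

(** On this face [g] vanishes and the label [None] is missing, so [t] reduces to the coboundary of
    [door_edge]. *)
Let face_xn_t y z : y < N -> z < N -> face_x vtx t N y z =
  boundary2 door_edge (lrep (vtx N y z)) (lrep (vtx N y.+1 z)) (lrep (vtx N y.+1 z.+1)) (+)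
  boundary2 door_edge (lrep (vtx N y z)) (lrep (vtx N y z.+1)) (lrep (vtx N y.+1 z.+1)).
Proof.
rewrite /N => hy hz.
have noN a b c a' b' c' :
    None \notin [:: lrep (vtx N a a'); lrep (vtx N b b'); lrep (vtx N c c')].
  by rewrite !inE ![None == _]eq_sym !negb_or !avoid_xn.
rewrite !boundary_door_edge // /face_x /square /t.
rewrite !far_g ?addbF //=; try (by apply: vtx_adj; lia);
  by rewrite inordK ?eqxx ?orbT; lia.
Qed.

Let face_x0_t y z : y < N -> z < N -> face_x vtx t 0 y z = false.
Proof.
rewrite /N => hy hz; apply: (@square_t None); try (by apply: vtx_adj; lia).
  by rewrite /N /= !inordK; lia.
by move=> v; rewrite !inE => /or4P[]/eqP->; exact: avoid_x0.
Qed.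

Let face_y0_t x z : x < N -> z < N -> face_y vtx t x 0 z = false.
Proof.
rewrite /N => hx hz; apply: (@square_t (Some true)); try (by apply: vtx_adj; lia).
  by rewrite /N /= !inordK; lia.
by move=> v; rewrite !inE => /or4P[]/eqP->; exact: avoid_y0.
Qed.

Let face_yn_t x z : x < N -> z < N -> face_y vtx t x N z = false.
Proof.
rewrite {1 2}/N => hx hz; apply: (@square_t None); try (by rewrite /N; apply: vtx_adj; lia).
  by rewrite /N /= !inordK; lia.
by move=> v; rewrite !inE => /or4P[]/eqP->; exact: avoid_yn.
Qed.

Let face_z0_t x y : x < N -> y < N -> face_z vtx t x y 0 = false.
Proof.
rewrite /N => hx hy; apply: (@square_t (Some false)); try (by apply: vtx_adj; lia).
  by rewrite /N /= !inordK; lia.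
by move=> v; rewrite !inE => /or4P[]/eqP->; exact: avoid_z0.
Qed.

Let face_zn_t x y : x < N -> y < N -> face_z vtx t x y N = false.
Proof.
rewrite {1 2}/N => hx hy; apply: (@square_t (Some true)); try (by rewrite /N; apply: vtx_adj; lia).
  by rewrite /N /= !inordK; lia.
by move=> v; rewrite !inE => /or4P[]/eqP->; exact: avoid_zn.
Qed.

Let odd_face_xn : \xor_(y < N) \xor_(z < N) face_x vtx t N y z = true.
Proof.
pose l y z := lrep (vtx N y z).
transitivity (\xor_(y < N) \xor_(z < N)
  (boundary2 door_edge (l y z) (l y.+1 z) (l y.+1 z.+1) (+)
   boundary2 door_edge (l y z) (l y z.+1) (l y.+1 z.+1))).
  by apply: eq_bigr => y _; apply: eq_bigr => z _; rewrite face_xn_t.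
rewrite (stokes_square l door_edge N).
(* The sides z = 0 and z = N each miss one of the two labels of a door edge. *)
rewrite [X in _ (+) X]big1 => [|y _]; last first.
  have := avoid_z0 N y; have := avoid_z0 N y.+1; rewrite -!/(l _ _).
  have := avoid_zn N y; have := avoid_zn N y.+1; rewrite -!/(l _ _).
  by case: (l y 0) (l y.+1 0) (l y N) (l y.+1 N) => [[[]|]|] [[[]|]|] [[[]|]|] [[[]|]|].
(* The side y = 0 carries only the label [Some None]. On the side y = N only the labels of a door
   edge remain, so the door edges are the changes of [s], which differs at the two ends. *)
pose s z := l N z == Some (Some true).
rewrite addbF (eq_bigr (fun z : 'I_N => s z (+) s z.+1)) => [|z _]; last first.
  have := avoid_yn N z; have := avoid_yn N z.+1; rewrite -!/(l _ _).
  have := avoid_xn N z; have := avoid_xn N z.+1; rewrite -!/(l _ _).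
  have := avoid_y0 true N z; have := avoid_y0 true N z.+1; rewrite -!/(l _ _).
  have := avoid_y0 false N z; have := avoid_y0 false N z.+1; rewrite -!/(l _ _) /s.
  by case: (l 0 z) (l 0 z.+1) (l N z) (l N z.+1) => [[[]|]|] [[[]|]|] [[[]|]|] [[[]|]|].
rewrite xor_telescope /s.
have := avoid_yn N 0; have := avoid_yn N N; have := avoid_xn N 0.
have := avoid_z0 N N; have := avoid_zn N N; rewrite -!/(l _ _).
by case: (l N 0) (l N N) => [[[]|]|] [[[]|]|].
Qed.

(** Stokes' formula makes the sum of the cocycle [t] over the boundary zero, while the face x = N
    contributes 1 and the other five contribute 0. *)
Lemma Sperner_contradiction : False.
Proof.
have := stokes_cube vtx t N; rewrite big1 => [|x _]; last first.
  by apply: big1 => y _; apply: big1 => z _; exact: cell_t.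
rewrite [X in _ (+) X (+) _]big1 => [|x _]; last first.
  by apply: big1 => z _; rewrite face_y0_t // face_yn_t.
rewrite [X in _ (+) X]big1 => [|x _]; last first.
  by apply: big1 => y _; rewrite face_z0_t // face_zn_t.
rewrite !addbF.
suff -> : \xor_(y < N) \xor_(z < N) (face_x vtx t 0 y z (+) face_x vtx t N y z) = true by [].
rewrite -[RHS]odd_face_xn; apply: eq_bigr => y _; apply: eq_bigr => z _.
by rewrite face_x0_t.
Qed.

End Label.

(** * Clusters *)

Lemma Q_degree n (u : Q n.+1) : #|[set v | adj u v]| <= 27.
Proof.
(* The offsets -1, 0, 1 are encoded as 0, 1, 2. *)
pose f (i : 'I_3 * 'I_3 * 'I_3) : Q n.+1 :=
  (inord (u.1.1 + i.1.1 - 1), inord (u.1.2 + i.1.2 - 1), inord (u.2 + i.2 - 1)).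
have -> : 27 = #|{: 'I_3 * 'I_3 * 'I_3}| by rewrite !card_prod card_ord.
apply: leq_trans (leq_imset_card f _); apply/subset_leq_card/subsetP => v.
rewrite inE => /Q_adj_near /and3P[hx hy hz]; apply/imsetP.
have coord (a b : 'I_n.+1) : a <= b + 1 <= a + 1 + 1 ->
    b = inord (a + (inord (b + 1 - a) : 'I_3) - 1).
  move=> h; apply: val_inj; have ltb := ltn_ord b.
  have -> : (inord (b + 1 - a) : 'I_3) = b + 1 - a :> nat by rewrite inordK; lia.
  by rewrite /= inordK; lia.
exists (inord (v.1.1 + 1 - u.1.1), inord (v.1.2 + 1 - u.1.2), inord (v.2 + 1 - u.2)) => //.
by rewrite /f /= -!coord //; case: (v) => [[]].
Qed.

Section Clusters.
Variables (n : nat).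
Local Notation V := ('I_n * 'I_n * 'I_n)%type.
Variables (U : {set V}) (b : V -> {set V}) (w r : nat).
Hypothesis bag_mem : forall v, v \in U -> v \in b v.
Hypothesis bag_card : forall v, v \in U -> #|b v| <= w.

Definition same_cluster : rel V :=
  fun u v => [&& u \in U, v \in U, b u == b v & near r u v].

Definition cluster_rep : V -> V := fingraph.root same_cluster.

(** A repetition-free chain inside one bag has at most [w] vertices, and each of its steps has
    length at most [r]. *)
Lemma cluster_rep_near v : near (r * w) v (cluster_rep v).
Proof.
have : connect same_cluster v (cluster_rep v) by exact: connect_root.
case/connectP=> p0 p0P; case/shortenP: p0P => p pP up _ ->.
have near_last x q : path same_cluster x q -> near (r * size q) x (last x q).
  elim: q x => [|y q IH] x /=; first by rewrite muln0 near_refl.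
  by case/andP=> /and4P[_ _ _ xy] /IH yq; rewrite mulnS; exact: near_trans xy yq.
apply: near_le (near_last v p pP); rewrite leq_mul2l; apply/orP; right.
case: p pP up => // y p pP up.
have vU : v \in U by case/andP: pP => /and4P[].
rewrite (leq_trans _ (bag_card vU)) // ltnW //.
rewrite -[_.+1]/(size (v :: y :: p)) -(card_uniqP up); apply/subset_leq_card/subsetP => x.
have all_bag z q : path same_cluster z q -> z \in U -> b z = b v ->
    {in z :: q, forall x, x \in b v}.
  elim: q z => [|z' q IH] z /=.
    by move=> _ zU zb y'; rewrite inE => /eqP->; rewrite -zb bag_mem.
  case/andP=> /and4P[_ z'U /eqP zz' _] qP zU zb y'; rewrite inE => /orP[/eqP->|].
    by rewrite -zb bag_mem.
  by apply: IH => //; rewrite -zz'.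
exact: all_bag.
Qed.

Lemma cluster_rep_eq u v : u \in U -> v \in U -> b u = b v -> near r u v ->
  cluster_rep u = cluster_rep v.
Proof.
move=> uU vU buv uv; apply/fingraph.rootP; last by apply: connect1; rewrite /same_cluster uU vU buv eqxx.
apply: sym_connect_sym => x y; rewrite /same_cluster near_sym [b x == _]eq_sym.
by rewrite andbCA.
Qed.

End Clusters.

(** The two sides are [~: A0] and [A0]; the latter lies in [~: A1] by disjointness. *)
Lemma two_tree_partitions (m w : nat) (A0 A1 : {set Q (2 * m).+1}) R0 R1 :
  [disjoint A0 & A1] -> 3 * (2 * w.+1 * w) + 2 < m ->
  tree_partition (@adj (Q (2 * m).+1)) w (~: A0) R0 -> #|R0| <= w ->
  tree_partition (@adj (Q (2 * m).+1)) w (~: A1) R1 -> #|R1| <= w -> False.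
Proof.
move=> dis m_large tp0 R0w tp1 R1w.
have [b0 [b0U b0w _ tri0 _]] := tree_partition_bags (@adj_sym _) tp0.
have [b1 [b1U b1w _ tri1 cob1]] := tree_partition_bags (@adj_sym _) tp1.
have b0m v : v \in ~: A0 -> v \in b0 v by case/b0U.
have b1m v : v \in ~: A1 -> v \in b1 v by case/b1U.
have b0c v : v \in ~: A0 -> #|b0 v| <= w by case/b0w=> [->|].
have b1c v : v \in ~: A1 -> #|b1 v| <= w by case/b1w=> [->|].
have U1 v : v \notin ~: A0 -> v \in ~: A1.
  by rewrite !inE negbK => /(disjointFr dis) ->.
pose rep0 := cluster_rep (~: A0) b0 1.
(* Two vertices within [w.+1] of the same representative are within [2 * w.+1] of each other, so
   inside one bag they share a cluster. *)
pose rep1 := cluster_rep (~: A1) b1 (2 * w.+1).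
pose rep v := if v \in ~: A0 then rep0 v else rep1 v.
have rep_near v : near (2 * w.+1 * w) v (rep v).
  rewrite /rep; case: ifP => _; last exact: cluster_rep_near.
  by apply: near_le (cluster_rep_near 1 b0m b0c v); nia.
have repA v : v \in ~: A0 -> rep v = rep0 v by rewrite /rep => ->.
have repB v : v \notin ~: A0 -> rep v = rep1 v by rewrite /rep => /negbTE ->.
have eqA x y : x \in ~: A0 -> y \in ~: A0 -> Q_adj x y -> b0 x == b0 y -> rep x == rep y.
  move=> xA yA /Q_adj_near xy /eqP bxy; rewrite !repA //; apply/eqP.
  exact: cluster_rep_eq.
have eqB x y : x \notin ~: A0 -> y \notin ~: A0 -> near (2 * w.+1) x y ->
    b1 x == b1 y -> rep x == rep y.
  move=> xA yA xy /eqP bxy; rewrite !repB //; apply/eqP.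
  by apply: cluster_rep_eq => //; exact: U1.
have near1 x y : Q_adj x y -> near (2 * w.+1) x y.
  by move=> /Q_adj_near; apply: near_le; lia.
pose splits (E : {set _}) p := forall u u' v v', E = [set rep u; rep u'] ->
    u \in ~: A0 -> u' \in ~: A0 -> v \notin ~: A0 -> v' \notin ~: A0 ->
    Q_adj u v -> Q_adj u v' -> Q_adj u' v -> Q_adj u' v' -> Q_adj v v' ->
    p v (+) p v' = full (lab (rep u)) (lab (rep u')) (lab (rep v)) (lab (rep v')).
have /boolp.choice[phi phiP] E : exists p, splits E p.
  pose nearE v := [forall a in E, near w.+1 v a].
  (* Near [E] a bag meets a single cluster, so its label depends on the bag alone; the value [None]
     for bags with no vertex near [E] is arbitrary. *)
  pose bag_lab B :=
    if [pick v | [&& v \notin ~: A0, b1 v == B & nearE v]] is Some v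
    then lab (rep v) else None.
  (* Quantifying over [E] makes [c] a function of bags only, to which the coboundary property of the
     second tree applies. *)
  pose c B B' := [exists a in E, exists a' in E,
    full (lab a) (lab a') (bag_lab B) (bag_lab B')].
  have c_sym : symmetric c.
    move=> B B'; apply: eq_existsb => a; congr (_ && _).
    by apply: eq_existsb => a'; rewrite full_swap23.
  have c_irr : irreflexive c.
    move=> B; apply/exists_inP => -[a _ /exists_inP[a' _]].
    by rewrite /full /= !inE eqxx ?andbF.
  have [phi phiP] := cob1 c c_sym c_irr.
  exists (phi \o b1) => u u' v v' defE uA u'A vA v'A uv uv' u'v u'v' vv'.
  rewrite /= phiP ?U1 //.
  have nearEv x : Q_adj u x -> Q_adj u' x -> nearE x.
    move=> ux u'x; apply/forall_inP => a; rewrite defE !inE.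
    have nr y : y \in ~: A0 -> Q_adj y x -> near w.+1 x (rep y).
      move=> yA /Q_adj_near yx; rewrite repA // near_sym in yx *.
      have := near_trans yx (cluster_rep_near 1 b0m b0c y).
      by rewrite mul1n add1n.
    by case/orP=> /eqP->; exact: nr.
  have bag_labE x : x \notin ~: A0 -> nearE x -> bag_lab (b1 x) = lab (rep x).
    move=> xA xE; rewrite /bag_lab; case: pickP => [y /and3P[yA yx yE]|]; last first.
      by move=> /(_ x); rewrite xA eqxx xE.
    have uE : rep u \in E by rewrite defE !inE eqxx.
    have yu := forall_inP yE _ uE.
    have xu := forall_inP xE _ uE; rewrite near_sym in xu.
    congr lab; apply/eqP/eqB => //.
    by apply: near_le (near_trans yu xu); rewrite addnn mul2n.
  rewrite /c !bag_labE ?nearEv //; apply/exists_inP/idP.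
    case=> a aE /exists_inP[a' a'E]; move: aE a'E; rewrite defE !inE.
    by case/orP=> /eqP-> /orP[]/eqP->;
      [rewrite /full /= inE eqxx| |rewrite full_swap01|rewrite /full /= inE eqxx].
  move=> fl; exists (rep u); rewrite defE ?inE ?eqxx //; apply/exists_inP.
  by exists (rep u'); rewrite ?inE ?eqxx ?orbT.
apply: (@Sperner_contradiction m (~: A0) rep _ m_large rep_near _ _ phi).
- move=> x y z xA yA zA xy xz yz.
  by case/or3P: (tri0 x y z xA yA zA xy xz yz) => /eqA -> //; rewrite ?orbT.
- move=> x y z xA yA zA xy xz yz.
  by case/or3P: (tri1 x y z (U1 _ xA) (U1 _ yA) (U1 _ zA) xy xz yz) => /eqB -> //;
    rewrite ?orbT //; exact: near1.
by move=> u u' v v' uA u'A vA v'A _ uv uv' u'v u'v' vv'; exact: phiP.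
Qed.

Theorem corollary2 :
  ~ tw_fragile (fun G : sgraph => exists n : nat, 1 <= n /\ G = Q n).
Proof.
case/(_ 2 isT) => t frag; pose w := 48 * t.+1 * 27.
(* The least value with [3 * D + 2 < m], where [D = 2 * w.+1 * w] bounds the displacement by the
   contraction. *)
pose m := 3 * (2 * w.+1 * w) + 3.
have [|A [dis twA]] := frag (Q (2 * m).+1); first by exists (2 * m).+1.
have [R0 [tp0 le0]] := tw_tree_partition (isT : 0 < 27) (@Q_degree _) (twA ord0).
have [R1 [tp1 le1]] := tw_tree_partition (isT : 0 < 27) (@Q_degree _) (twA ord_max).
apply: two_tree_partitions (dis ord0 ord_max isT) _ tp0 le0 tp1 le1.
by rewrite /m; lia.
Qed.
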